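(* Let $q$ be a prime power, let $V$ be a vector space of finite dimension $n$ over $\mathbb{F}_q$, and let $C$ be a code in $(\mathrm{Sub}(V),d_S)$ with minimum distance $d$. Then $$|C|\le \sum_{k=0}^{\,n-\lfloor \frac{d-2}{2}\rfloor}{n-\lfloor \frac{d-1}{2}\rfloor \brack k}_q .$$
   Context: $\mathrm{Sub}(V)$ is the set of all subspaces of $V$, with the subspace distance $d_S(A,B):=\dim(A+B)-\dim(A\cap B)$. A code is a subset $C\subseteq \mathrm{Sub}(V)$ (its elements may have different dimensions), with minimum distance $d=\min\{d_S(A,B): A,B\in C,\ A\neq B\}$, defined when $C$ has at least two elements. The Gaussian number ${N\brack k}_q$ is the number of $k$-dimensional subspaces of an $N$-dimensional vector space over $\mathbb{F}_q$; in particular it is $0$ when $k>N$. *)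

(* Defs.v *)
From HB Require Import structures.
From mathcomp Require Import all_boot all_order all_algebra.

Set Implicit Arguments.
Unset Strict Implicit.
Unset Printing Implicit Defensive.

Local Open Scope nat_scope.

(* Finiteness of Sub(V) over a finite field, which MathComp does not declare:
   it makes {set {vspace V}} the type of codes, with cardinal #|_|. *)
Section FiniteVspace.
Import VectorInternalTheory.
Variables (F : finFieldType) (V : vectType F).
HB.instance Definition _ := [Countable of {vspace V} by <:].
HB.instance Definition _ := [Finite of {vspace V} by <:].
End FiniteVspace.

(* The subtraction on nat is never truncated here, as A :&: B <= A + B. *)
Definition subspace_dist (F : fieldType) (V : vectType F) (A B : {vspace V})
    : nat :=
  \dim (A + B)%VS - \dim (A :&: B)%VS.

(* Being an attained minimum, d exists only if C has at least two elements. *)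
Definition is_min_distance (F : finFieldType) (V : vectType F)
    (C : {set {vspace V}}) (d : nat) : Prop :=
  (exists A B : {vspace V},
     [/\ A \in C, B \in C, A != B & subspace_dist A B = d]) /\
  (forall A B : {vspace V},
     A \in C -> B \in C -> A != B -> d <= subspace_dist A B).

(* Gaussian number [N choose k]_q with q = #|F|, counted in the model F^N of
   the N-dimensional vector space over F. *)
Definition gaussian_number (F : finFieldType) (N k : nat) : nat :=
  #|[set U : {vspace 'rV[F]_N} | \dim U == k]|.

(* Main.v *)
(* If W has codimension t in V and A, B meet W in the same subspace, then
   A :&: B contains A :&: W and B :&: W, so it has codimension at most t in both
   A and B, and subspace_dist A B <= 2 * t.  With t the floor of (d - 1) / 2,
   intersection with W is therefore injective on C, and #|C| is at most the
   number of subspaces of W, which is the whole sum since n - t is at most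
   n minus the floor of (d - 2) / 2. *)
Require Import Defs.
From mathcomp Require Import all_boot all_order all_algebra.
From mathcomp Require Import zify.
Import passmx.

Local Open Scope nat_scope.

(** Sort the subspaces by dimension; terms with [k > m] vanish, so the sum may run past [m]. *)
Lemma card_vspace_gaussian (F : finFieldType) (m N : nat) :
  m < N -> #|{: {vspace 'rV[F]_m}}| = \sum_(0 <= k < N) gaussian_number F m k.
Proof.
case: N => // N; rewrite ltnS => le_mN.
have dimK (U : {vspace 'rV[F]_m}) : nat_of_ord (inord (\dim U) : 'I_N.+1) = \dim U.
  rewrite inordK // ltnS (leq_trans _ le_mN) //.
  by rewrite (leq_trans (dimvS (subvf U))) // dimvf /dim /= mul1n.
rewrite big_mkord -sum1_card.
rewrite (partition_big (fun U : {vspace 'rV[F]_m} => inord (\dim U) : 'I_N.+1) xpredT) //=.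
apply: eq_bigr => k _; rewrite sum1_card /gaussian_number cardsE.
by apply: eq_card => U; rewrite -[in RHS]topredE /= -(dimK U).
Qed.

Lemma subspace_distE {F : fieldType} {V : vectType F} (A B : {vspace V}) :
  subspace_dist A B + 2 * \dim (A :&: B)%VS = \dim A + \dim B.
Proof.
have := dimv_sum_cap A B; have := dimvS (subv_trans (capvSl A B) (addvSl A B)).
by rewrite /subspace_dist; lia.
Qed.

Lemma subspace_dist_gt0 {F : fieldType} {V : vectType F} (A B : {vspace V}) :
  A != B -> 0 < subspace_dist A B.
Proof.
apply: contraNltn; rewrite leqn0 => /eqP dist0.
have := subspace_distE A B; rewrite dist0 => dimAB.
have leA := dimvS (capvSl A B); have leB := dimvS (capvSr A B).
have capA : (A :&: B)%VS == A by rewrite eqEdim capvSl; lia.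
have capB : (A :&: B)%VS == B by rewrite eqEdim capvSr; lia.
by rewrite -{1}(eqP capA) (eqP capB).
Qed.

Lemma subspace_dist_cap {F : fieldType} {V : vectType F} (A B W : {vspace V}) :
  (A :&: W = B :&: W)%VS ->
  subspace_dist A B + 2 * \dim W <= 2 * \dim {:V}.
Proof.
move=> eqW.
have subAB : (A :&: W <= A :&: B)%VS by rewrite subv_cap capvSl eqW capvSl.
have := dimvS subAB; have dimAB := subspace_distE A B.
have := dimv_sum_cap A W; have := dimv_sum_cap B W; rewrite -eqW.
have := dimvS (subvf (A + W)%VS); have := dimvS (subvf (B + W)%VS).
lia.
Qed.

(** Provides the subspace [W] as an image of ['rV[F]_m], the space in which [gaussian_number]
    counts. *)
Lemma exists_limg_dim {F : fieldType} {V : vectType F} {m : nat} :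
  m <= \dim {:V} -> exists f : 'Hom('rV[F]_m, V), \dim (limg f) = m.
Proof.
move=> le_m; pose b := vbasis {:V}.
pose P : 'M[F]_(m, \dim {:V}) := pid_mx m; pose g := vecof b \o mulmxr P.
exists (linfun g).
rewrite limg_dim_eq ?dimvf ?/dim /= ?mul1n //.
apply/eqP; rewrite -subv0; apply/subvP => u /memv_capP[_].
rewrite memv_ker (lfunE g) /= (vecof_eq0 (vbasisP _)) memv0 => /eqP uP0.
(* A right inverse of [P] makes [u *m P = 0] force [u = 0]. *)
have PK : (P *m pid_mx m = 1%:M :> 'M[F]_m)%R.
  by rewrite mul_pid_mx minnn (minn_idPr le_m) pid_mx_1.
by rewrite -[u]mulmx1 -PK mulmxA uP0 mul0mx.
Qed.

Lemma card_code_le {F : finFieldType} {V : vectType F} (C : {set {vspace V}})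
    (m : nat) :
  m <= \dim {:V} ->
  (forall A B, A \in C -> B \in C -> A != B ->
     2 * \dim {:V} < subspace_dist A B + 2 * m) ->
  #|C| <= #|{: {vspace 'rV[F]_m}}|.
Proof.
move=> /exists_limg_dim[f dimf] distC.
(* [f @^-1: A] encodes [A :&: W] for [W = limg f], carried back to ['rV[F]_m]. *)
rewrite -(@card_in_imset _ _ (fun A => f @^-1: A)%VS C) ?max_card //.
move=> A B AC BC /= eqf; apply/eqP; apply/negPn/negP => neqAB.
have := distC A B AC BC neqAB; rewrite ltnNge -{1}dimf subspace_dist_cap //.
rewrite -(lpreimK (capvSr A (limg f))) -(lpreimK (capvSr B (limg f))).
by rewrite !lpreim_cap_limg eqf.
Qed.

(* The bounds are computed in int, where %/ is the floor of the quotient: for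
   d = 1 the floor of (d - 2) / 2 is -1, which nat subtraction would lose.
   The absolute values only convert to nat: 1 <= d <= n, so both differences
   are nonnegative. *)
Theorem corollary2 (F : finFieldType) (V : vectType F) (n : nat)
    (hn : \dim {:V} = n) (C : {set {vspace V}}) (d : nat)
    (hd : is_min_distance C d) :
  #|C| <= \sum_(0 <= k < (absz (n%:Z - ((d%:Z - 2)%R %/ 2)%Z)%R).+1)
            gaussian_number F (absz (n%:Z - ((d%:Z - 1)%R %/ 2)%Z)%R) k.
Proof.
case: hd => [[A [B [_ _ neqAB distAB]]] distC].
have d_gt0 : 0 < d by rewrite -distAB subspace_dist_gt0.
have d_le : d <= n.
  by rewrite -distAB -hn (leq_trans (leq_subr _ _)) // dimvS ?subvf.
rewrite -card_vspace_gaussian; last by lia.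
apply: card_code_le => [|A' B' AC BC neq]; first by lia.
by have := distC A' B' AC BC neq; lia.
Qed.
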